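(* Let $\alpha>1$ and let $\mathcal C=\{C_n,M_n\}_{n\in\mathbb N}$ be any (at most) countable collection of disjoint closed sets $C_n\subset[0,\infty)$ with the block property (defined in the context) and positive real numbers $M_n$. Let $$\mathcal F_{\mathcal C,\alpha}=\Big\{w\in\mathscr M^\alpha_+([0,\infty)):\ C_n=A_n(w),\ M_n=\int_{A_n(w)}w(k)\,dk\ \text{ for all } n\Big\}.$$ For a nonnegative bounded Radon measure $v$ on $[0,\infty)$, the following statements are equivalent: (i) $v\in\mathcal F_{\mathcal C,\alpha}$ and $D_\alpha(v)=0$; (ii) $M_\alpha(v)=\min\{M_\alpha(w):w\in\mathcal F_{\mathcal C,\alpha}\}$; (iii) $v=\sum_{n=0}^\infty M_n\delta_{k_n}$, where $k_n=\min\{k\in C_n\}$.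
   Context: Measures. $\mathscr M_+([0,\infty))$ is the set of nonnegative bounded Radon measures on $[0,\infty)$; one writes $\int\varphi(k)v(k)dk$ for $\int\varphi\,dv$. $M_\alpha(v)=\int_{[0,\infty)}k^\alpha v(k)\,dk$ and $\mathscr M^\alpha_+([0,\infty))=\{v\in\mathscr M_+([0,\infty)):M_\alpha(v)<\infty\}$. Kernel. Fix $m>0$ and, for $k,k'\ge0$ not both zero, $$\mathcal B(k,k')=e^{\frac{k+k'}2}\int_{-1}^1\frac{1+s^2}{w}\,\exp\Big(-\frac{m(k-k')^2}{2w^2}-\frac{w^2}{8m}\Big)ds,\qquad w=\sqrt{k^2+k'^2-2kk's}.$$ (The inverse-temperature parameter $\beta$ is taken equal to $1$.) Cut-off. Fix $\theta\in(0,1)$, $\delta_*>0$ and $\rho_*=\frac{1-\theta}{\sqrt{\theta(1+\theta)\delta_*}}$. Let $D\subset[0,\infty)^2$ be the set of $(k,k')$ such that $|k-k'|\le\rho_*\sqrt{kk'(k+k')}$ if $(k,k')\in[0,\delta_*]^2$, and $\theta k\le k'\le\theta^{-1}k$ if $(k,k')\notin[0,\delta_*]^2$. The function $\Phi$ satisfies: $\Phi(k,k')=\Phi(k',k)$; $\Phi\in C([0,\infty)^2\setminus\{(0,0)\})$; $\operatorname{supp}\Phi=D$; and $\Phi=1$ on the set $D_1\subset D$ of $(k,k')$ such that $|k-k'|\le\rho_1\sqrt{kk'(k+k')}$ if $(k,k')\in[0,\delta_*]^2$ and $\theta_1k\le k'\le\theta_1^{-1}k$ otherwise, for some $\theta_1\in(\theta,1)$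 and $\rho_1=\rho_1(\theta_1,\delta_* )>0$. The product $B=\Phi\mathcal B$ satisfies $B\ge0$ and, for some constant $C_*>0$, $B(k,k')\le B\big(\tfrac{k+k'}2,\tfrac{k+k'}2\big)\le \frac{C_*e^{(k+k')/2}}{k+k'}$ on $D$. Dissipation. $$D_\alpha(v)=\iint_{(0,\infty)^2}\frac{\Phi(k,k')\mathcal B(k,k')}{kk'}\big(e^{-k}-e^{-k'}\big)(k^\alpha-k'^\alpha)\,v(k)v(k')\,dk\,dk'.$$ Blocks of a closed set and the sets $A_n(v)$. Let $\gamma_1(k)=\min\{k'\ge0:(k,k')\in D\}$ for $k\ge0$. Given a closed set $S\subset[0,\infty)$, write $[0,\infty)\setminus S$ as the disjoint union of its connected components $I_j$ (relatively open intervals, with endpoints $a_j<b_j$, where $a_j=0$ if $I_j=[0,b_j)$, and with the convention $\gamma_1(\infty)=\infty$). Let $\mathcal I=\{I_j:\gamma_1(b_j)\ge a_j\}$ and let $\{E_n\}$ be the (at most countably many) connected components of $[0,\infty)\setminus\bigcup_{I\in\mathcal I}I$. The blocks of $S$ are the sets $E_n\cap S$; they are closed, pairwise disjoint, and their union is $S$. For $v\in\mathscr M_+([0,\infty))$, $\{A_n(v)\}$ is the collection of blocks of $S=\operatorname{supp}v$. A collection $\{C_n\}$ has the block property if $\bigcup_nC_n$ is closed and the $C_n$ are exactly its blocks. The equality ''$C_n=A_n(v)$ for all $n$'' means that the collections coincide with a matching enumeration. (Informally, two points of $S$ lie in the same block when they are linked by $\Phi\neq0$, directly or through a chain of intermediate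 points.)
   Formalization: Membership of v in the family F is added to (iii), and (ii) is read as ''v is a minimiser in F''; supp Φ = D is taken to include Φ ≠ 0 at every interior point of D. As literally stated the equivalence fails, e.g. v = Mδ_1 with C = {[1,1+ε]}. *)

(* Defs.v *)
From HB Require Import structures.
From mathcomp Require Import all_boot all_order all_algebra.
From mathcomp Require Import all_classical all_reals all_analysis.

Set Implicit Arguments.
Unset Strict Implicit.
Unset Printing Implicit Defensive.

Import Order.TTheory GRing.Theory Num.Theory.
Import numFieldNormedType.Exports.

Local Open Scope classical_set_scope.
Local Open Scope ring_scope.

Definition is_minimum {d} {T : porderType d} (A : set T) (x : T) : Prop :=
  A x /\ lbound A x.

Section Kernel.
Variable R : realType.
Implicit Types (m theta delta rho : R) (Phi : R * R -> R) (p : R * R).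

Definition kernel_w (k k' s : R) : R :=
  Num.sqrt (k ^+ 2 + k' ^+ 2 - 2 * k * k' * s).

(* When k = k' > 0 the integrand is singular at s = 1, where w = 0; this is a
   null set and the Lebesgue integral converges. *)
Definition calB m (k k' : R) : R :=
  expR ((k + k') / 2) *
  \int[lebesgue_measure]_(s in `[-1, 1])
    ((1 + s ^+ 2) / kernel_w k k' s *
     expR (- (m * (k - k') ^+ 2 / (2 * kernel_w k k' s ^+ 2))
           - kernel_w k k' s ^+ 2 / (8 * m))).

Definition quadrant_star : set (R * R) :=
  [set p | 0 <= p.1 /\ 0 <= p.2 /\ p != (0, 0)].

Definition region rho theta delta : set (R * R) :=
  [set p | let: (k, k') := p in
     0 <= k /\ 0 <= k' /\
     if (k <= delta) && (k' <= delta)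
     then `|k - k'| <= rho * Num.sqrt (k * k' * (k + k'))
     else theta * k <= k' <= theta^-1 * k].

Definition rho_star theta delta : R :=
  (1 - theta) / Num.sqrt (theta * (1 + theta) * delta).

Definition regionD theta delta : set (R * R) :=
  region (rho_star theta delta) theta delta.

Definition cutB m Phi (k k' : R) : R := Phi (k, k') * calB m k k'.

(* Phi lives on [0,oo)^2 minus the origin: its values elsewhere are arbitrary.
   [cutoff_supp] alone would let Phi vanish at interior points of D, i.e.
   between points that D links; [cutoff_neq0] records the intended meaning of
   "supp Phi = D", that Phi links exactly the interior of D (on the boundary
   Phi = 0 by continuity). *)
Record cutoff m theta delta Phi : Prop := Cutoff {
  cutoff_sym : forall k k', quadrant_star (k, k') -> Phi (k, k') = Phi (k', k);
  cutoff_continuous : {within quadrant_star, continuous Phi};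
  cutoff_supp :
    closure [set p | quadrant_star p /\ Phi p != 0] = regionD theta delta;
  cutoff_neq0 : forall p, (regionD theta delta)° p -> Phi p != 0;
  cutoff_eq1 : exists theta1 rho1, [/\ theta < theta1 < 1, 0 < rho1,
    region rho1 theta1 delta `<=` regionD theta delta &
    forall p, region rho1 theta1 delta p -> p != (0, 0) -> Phi p = 1];
  cutoff_ge0 : forall k k', quadrant_star (k, k') -> 0 <= cutB m Phi k k';
  cutoff_bound : exists2 Cstar, 0 < Cstar &
    forall k k', regionD theta delta (k, k') -> (k, k') != (0, 0) ->
      cutB m Phi k k' <= cutB m Phi ((k + k') / 2) ((k + k') / 2)
        <= Cstar * expR ((k + k') / 2) / (k + k') }.

End Kernel.

Section Blocks.
Variable R : realType.
Implicit Types (theta delta : R) (S A I : set R).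

Definition components A : set (set R) := connected_component A @` A.

(* For k >= 0 the section of D at k is closed, contains k and is bounded below
   by 0, so the infimum is attained. *)
Definition gamma1 theta delta (b : \bar R) : \bar R :=
  if b is k%:E then (inf [set k' | regionD theta delta (k, k')])%:E else +oo%E.

(* The infimum and supremum are the endpoints a_j and b_j of the gap. *)
Definition separating_gap theta delta S I : Prop :=
  components (`[0, +oo[ `\` S) I /\
  (ereal_inf (EFin @` I) <= gamma1 theta delta (ereal_sup (EFin @` I)))%E.

Definition blocks theta delta S : set (set R) :=
  [set E `&` S | E in components
     (`[0, +oo[ `\` \bigcup_(I in separating_gap theta delta S) I)].

(* The collection is indexed by J, a set of naturals: at most countable. *)
Definition block_property theta delta (J : set nat) (C : nat -> set R) : Prop :=
  closed (\bigcup_(n in J) C n) /\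
  C @` J = blocks theta delta (\bigcup_(n in J) C n).

End Blocks.

Section Measures.
Variable R : realType.

(* Finite Borel measures on the line are automatically Radon; those on [0,oo)
   are the ones that do not charge the negative half-line. *)
Notation fmeasure := {finite_measure set (measurableTypeR R) -> \bar R}.
Implicit Types (v w : fmeasure) (alpha : R).

Definition on_halfline v : Prop := v (`]-oo, 0[%classic : set R) = 0%E.

Definition supp v : set R :=
  [set x | forall U : set R, open U -> U x -> (0 < v U)%E].

Definition moment alpha v : \bar R :=
  (\int[v]_(k in `[0%R, +oo[) (k `^ alpha)%:E)%E.

(* For alpha > 0 the integrand is nonpositive, so that the extended-real
   integral is always meaningful. *)
Definition dissipation m (Phi : R * R -> R) alpha v : \bar R :=
  (\int[(v \x v)%E]_(p in `]0%R, +oo[ `*` `]0%R, +oo[)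
    (Phi p * calB m p.1 p.2 / (p.1 * p.2)
     * (expR (- p.1) - expR (- p.2)) * (p.1 `^ alpha - p.2 `^ alpha))%R%:E)%E.

Definition calF theta delta (J : set nat) (C : nat -> set R) (M : nat -> R)
    alpha : set fmeasure :=
  [set w | [/\ on_halfline w, (moment alpha w < +oo)%E,
     C @` J = blocks theta delta (supp w) &
     forall n, J n -> w (C n) = (M n)%:E]].

(* Each C n with n in J is closed, nonempty and bounded below, so that inf (C n)
   is its minimum. *)
Definition is_atomic_sum (J : set nat) (C : nat -> set R) (M : nat -> R) v :
    Prop :=
  forall A : set R, measurable A ->
    v A = (\sum_(n <oo | n \in J) (M n)%:E * \d_(inf (C n)) A)%E.

End Measures.

(* Main.v *)
Require Import Defs.
From HB Require Import structures.
From mathcomp Require Import all_boot all_order all_algebra.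
From mathcomp Require Import all_classical all_reals all_analysis measurable_realfun.
From mathcomp Require Import ring lra.

Set Implicit Arguments.
Unset Strict Implicit.
Unset Printing Implicit Defensive.

Import Order.TTheory GRing.Theory Num.Theory.
Import numFieldNormedType.Exports.
Local Open Scope classical_set_scope.
Local Open Scope ring_scope.

(* If two points of the support, at distinct positive heights, are in the
   interior of D, then the dissipation density is bounded away from 0 near the
   corresponding pair and D_alpha(v) < 0. Hence D_alpha(v) = 0 makes every gap of
   supp v separating, and every block is a single point. Conversely, gamma_1 is
   nondecreasing, so that points of distinct blocks are never linked and a
   measure carried by one point per block has zero dissipation. All three
   conditions are compared with: v charges each C_n only at its minimum, the
   minimum point being where k^alpha is smallest on C_n. *)

(** Points are linked when the pair is in the interior of D, where [Phi] is nonzero, whereas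
    [gamma1] and the separating gaps refer to the closed set D. Two monotonicity facts bridge this
    mismatch: if (y, x) is in D, so is (b, x) for x <= b <= y; and if (b, x) is in D, then (b, a) is
    interior for x < a < b. So an interior link across a gap puts gamma_1 of its right end strictly
    below its left end, while an unlinked pair 0 < a < b satisfies a <= gamma_1(b). The dissipation
    does not see the point 0, but a gap starting at 0 is separating anyway, since gamma_1 >= 0. A
    block crossed by no gap could still contain an interval; this is excluded because the diagonal
    is interior to D, so that close points are linked. The second obstacle is measurability: the
    dissipation density is only compared with constants times indicators of measurable sets, from
    above to show that an integral vanishes and from below to show that it is positive. *)

(** * Geometry of the region D and of gamma_1 *)

Section Geometry.
Variable R : realType.
Implicit Types (theta delta x y k b : R) (p : R * R).

(** Squaring removes both square roots and leaves a cubic inequality, which suits continuity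
    arguments and [nra]. *)
Lemma rho_star_region theta delta k b : 0 < theta < 1 -> 0 < delta ->
  0 <= k -> 0 <= b ->
  (`|k - b| <= rho_star theta delta * Num.sqrt (k * b * (k + b))) =
  (theta * (1 + theta) * delta * (k - b) ^+ 2 <=
     (1 - theta) ^+ 2 * (k * b * (k + b))).
Proof.
move=> /andP[t0 t1] d0 k0 b0.
have c0 : 0 < theta * (1 + theta) * delta by rewrite !mulr_gt0// addr_gt0.
have r0 : 0 <= rho_star theta delta.
  by rewrite /rho_star divr_ge0 ?sqrtr_ge0// subr_ge0 ltW.
have kb0 : 0 <= k * b * (k + b) by rewrite !mulr_ge0// addr_ge0.
rewrite -ler_sqr ?nnegrE//; last by rewrite mulr_ge0// sqrtr_ge0.
rewrite exprMn sqr_sqrtr// /rho_star expr_div_n sqr_sqrtr ?(ltW c0)//.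
by rewrite real_normK ?num_real// mulrAC ler_pdivlMr// mulrC.
Qed.

(** Inside the small square D is given by the cubic inequality alone. Asking for the cone as well
    gives one condition that works on both sides of the edge of the square, so its strict version is
    open even there. *)
Lemma regionD_intro theta delta k b : 0 < theta < 1 -> 0 < delta ->
  0 <= k -> 0 <= b -> theta * b <= k -> theta * k <= b ->
  delta < k \/ theta * (1 + theta) * delta * (k - b) ^+ 2 <=
     (1 - theta) ^+ 2 * (k * b * (k + b)) ->
  regionD theta delta (k, b).
Proof.
move=> t01 d0 k0 b0 bk kb H; do 2 split => //; case: ifPn => [/andP[kd bd]|_].
  case: H => [|H]; first by rewrite ltNge kd.
  by rewrite rho_star_region.
by case/andP: t01 => t0 _; rewrite kb/= ler_pdivlMl.
Qed.

Lemma interior_regionD theta delta k b : 0 < theta < 1 -> 0 < delta ->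
  0 < k -> 0 < b -> theta * b < k -> theta * k < b ->
  delta < k \/ theta * (1 + theta) * delta * (k - b) ^+ 2 <
     (1 - theta) ^+ 2 * (k * b * (k + b)) ->
  (regionD theta delta)° (k, b).
Proof.
move=> t01 d0 k0 b0 bk kb H.
have cf : continuous (@fst R R) by move=> ?; exact: cvg_fst.
have cs : continuous (@snd R R) by move=> ?; exact: cvg_snd.
have cM (f g : R * R -> R) : continuous f -> continuous g ->
    continuous (fun p => f p * g p) by move=> cf' cg p; apply: cvgM; [exact: cf'|exact: cg].
have cD (f g : R * R -> R) : continuous f -> continuous g ->
    continuous (fun p => f p + g p) by move=> cf' cg p; apply: cvgD; [exact: cf'|exact: cg].
have cN (f : R * R -> R) : continuous f ->
    continuous (fun p => - f p) by move=> cf' p; apply: cvgN; exact: cf'.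
have cC (a : R) : continuous (fun p : R * R => a) by move=> p; exact: cvg_cst.
have near_lt (f g : R * R -> R) : continuous f -> continuous g ->
    f (k, b) < g (k, b) -> \forall p \near (k, b), f p < g p.
  move=> cf' cg fg; near=> p; rewrite -subr_gt0; near: p.
  apply: (@cvgr_gt R _ _ _ (fun p => g p - f p) (g (k, b) - f (k, b))).
    by apply: cvgB; [exact: cg|exact: cf'].
  by rewrite subr_gt0.
have n1 := near_lt _ _ (cC 0) cf k0.
have n2 := near_lt _ _ (cC 0) cs b0.
have n3 := near_lt _ _ (cM _ _ (cC theta) cs) cf bk.
have n4 := near_lt _ _ (cM _ _ (cC theta) cf) cs kb.
suff n5 : \forall p \near (k, b), delta < p.1 \/
    theta * (1 + theta) * delta * (p.1 - p.2) ^+ 2 <=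
    (1 - theta) ^+ 2 * (p.1 * p.2 * (p.1 + p.2)).
  rewrite /interior /=; near=> p; rewrite (surjective_pairing p).
  apply: regionD_intro => //; try apply: ltW;
    near: p; assumption.
case: H => [kd|H].
  have n6 := near_lt _ _ (cC delta) cf kd.
  by near=> p; left; near: p; exact: n6.
have cBfs := cD _ _ cf (cN _ cs).
have n6 := near_lt _ _
  (cM _ _ (cC (theta * (1 + theta) * delta)) (cM _ _ cBfs cBfs))
  (cM _ _ (cC ((1 - theta) ^+ 2)) (cM _ _ (cM _ _ cf cs) (cD _ _ cf cs))) H.
by near=> p; right; apply: ltW; near: p; exact: n6.
Unshelve. all: by end_near. Qed.

(** The form in which the monotonicity of gamma_1 is used. *)
Lemma regionD_decr theta delta x b y : 0 < theta < 1 -> 0 < delta ->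
  x <= b -> b <= y -> regionD theta delta (y, x) -> regionD theta delta (b, x).
Proof.
move=> t01 d0 xb yb [y0 [x0 H]]; have [t0 t1] := andP t01.
have b0 : 0 <= b by exact: le_trans xb.
(* the quotients (b - x) / b and (b - x) / (b + x) increase with b *)
have mono z : b <= z -> theta * (1 + theta) * delta * (z - x) ^+ 2 <=
    (1 - theta) ^+ 2 * (z * x * (z + x)) ->
    theta * (1 + theta) * delta * (b - x) ^+ 2 <=
    (1 - theta) ^+ 2 * (b * x * (b + x)).
  move=> bz Hz.
  have [z0|z0] := leP z 0.
    have -> : b = 0 by lra.
    have -> : x = 0 by lra.
    by rewrite subrr expr0n/= !mulr0 !mul0r mulr0.
  have zx : 0 < z * (z + x) by rewrite mulr_gt0// ltr_pwDl.
  rewrite -(ler_pM2r zx); apply: (@le_trans _ _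
      (theta * (1 + theta) * delta * (z - x) ^+ 2 * (b * (b + x)))).
    have c0 : 0 < theta * (1 + theta) * delta by rewrite !mulr_gt0 ?addr_gt0.
    set c := _ * delta in c0 *; rewrite -!(mulrA c) ler_pM2l//.
    have e1 : (b - x) * z <= (z - x) * b by nra.
    have e2 : (b - x) * (z + x) <= (z - x) * (b + x) by nra.
    have := ler_pM _ _ e1 e2; rewrite !mulr_ge0; lra.
  have := ler_wpM2r (_ : 0 <= b * (b + x)) Hz.
  rewrite mulr_ge0// ?addr_ge0// => /(_ isT) /le_trans; apply.
  by rewrite le_eqVlt; apply/orP; left; apply/eqP; ring.
do 2 split => //; case: ifPn => [/andP[bd xd]|].
  rewrite rho_star_region//; move: H; case: ifPn => [/andP[yd _]|].
    by rewrite rho_star_region//; exact: mono.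
  rewrite xd andbT -ltNge => dy /andP[tyx _].
  (* Here b <= delta < y, so the two descriptions of D must be matched at height delta. The constant
     [rho_star] is the one for which the cubic inequality is an equality at (delta, theta *
     delta). *)
  apply: (mono delta) => //.
  have tdx : theta * delta <= x by rewrite (le_trans _ tyx)// ler_pM2l// ltW.
  have e1 : (delta - x) ^+ 2 <= ((1 - theta) * delta) ^+ 2.
    by rewrite ler_sqr ?nnegrE; [lra|lra|apply: mulr_ge0; lra].
  have e2 : theta * delta * ((1 + theta) * delta) <= x * (delta + x).
    by apply: ler_pM; [nra|nra|lra|lra].
  rewrite -(ler_pM2r d0).
  have := ler_pM _ _ e2 e1; rewrite sqr_ge0 => /(_ _ isT).
  rewrite !mulr_ge0 ?addr_ge0 ?(ltW t0) ?(ltW d0)// => /(_ isT) e3.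
  by apply: le_trans (le_trans e3 _); rewrite le_eqVlt; apply/orP; left;
    apply/eqP; ring.
move=> bxd; move: H; case: ifPn => [/andP[yd xd]|_].
  by move: bxd; rewrite (le_trans yb yd) xd.
move=> /andP[tyx _]; rewrite (le_trans _ tyx) ?ler_pM2l//=.
rewrite ler_pdivlMl// (le_trans _ xb)// -[leRHS]mul1r ler_wpM2r// ltW//.
Qed.

(** Raising x to a makes every inequality strict. This leads from the closed D of [gamma1] to the
    interior, where points are linked. *)
Lemma interior_regionD_lt theta delta x a b : 0 < theta < 1 -> 0 < delta ->
  x < a -> a < b -> regionD theta delta (b, x) -> (regionD theta delta)° (b, a).
Proof.
move=> t01 d0 xa ab [b0 [x0 H]]; have [t0 t1] := andP t01.
have a_gt0 : 0 < a by exact: (le_lt_trans _ xa).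
have b_gt0 : 0 < b by exact: lt_trans ab.
have tab : theta * a < b by nra.
move: H; case: ifPn => [/andP[bd xd]|H /andP[tbx _]]; last first.
  apply: interior_regionD => //; first exact: (le_lt_trans tbx xa).
  by left; rewrite ltNge; apply: contra H => bd; rewrite bd/=; lra.
rewrite rho_star_region// => H.
have c0 : 0 < theta * (1 + theta) * delta by rewrite !mulr_gt0// addr_gt0.
have q : theta * (1 + theta) * delta * (b - a) ^+ 2 <
     (1 - theta) ^+ 2 * (b * a * (b + a)).
  apply: (@lt_le_trans _ _ (theta * (1 + theta) * delta * (b - x) ^+ 2)).
    by rewrite ltr_pM2l// ltr_sqr ?nnegrE; lra.
  apply: (le_trans H); apply: ler_wpM2l; first exact: sqr_ge0.
  by apply: ler_pM; [nra|lra|nra|lra].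
apply: interior_regionD => //; last by right.
(* In the small square the strict cubic inequality forces the cone: if a <= theta * b, it also holds
   at theta * b, where it reduces to delta < b. *)
rewrite ltNge; apply/negP => atb.
have : theta * (1 + theta) * delta * ((1 - theta) * b) ^+ 2 <
    (1 - theta) ^+ 2 * (b * (theta * b) * (b + theta * b)).
  apply: (le_lt_trans _ (lt_le_trans q _)).
    rewrite ler_pM2l// ler_sqr ?nnegrE; [lra|nra|lra].
  apply: ler_wpM2l; first exact: sqr_ge0.
  by apply: ler_pM; [nra|lra|nra|lra].
have e : 0 < theta * (1 + theta) * (1 - theta) ^+ 2 * b ^+ 2.
  do 3?[apply: mulr_gt0] => //; rewrite ?exprn_gt0 ?subr_gt0//; lra.
rewrite (_ : theta * _ * _ * _ =
  theta * (1 + theta) * (1 - theta) ^+ 2 * b ^+ 2 * delta); last by ring.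
rewrite (_ : (1 - theta) ^+ 2 * (b * (theta * b) * (b + theta * b)) =
  theta * (1 + theta) * (1 - theta) ^+ 2 * b ^+ 2 * b); last by ring.
by rewrite ltr_pM2l// ltNge bd.
Qed.

Lemma interior_regionD_diag theta delta z : 0 < theta < 1 -> 0 < delta ->
  0 < z -> (regionD theta delta)° (z, z).
Proof.
move=> t01 d0 z0; have [t0 t1] := andP t01.
have tz : theta * z < z by rewrite gtr_pMl.
apply: interior_regionD => //; right.
by rewrite subrr expr0n/= mulr0 !mulr_gt0 ?exprn_gt0 ?subr_gt0 ?addr_gt0.
Qed.

Lemma interior_fst_snd (A : set (R * R)) x y : A° (y, x) ->
  exists2 e, 0 < e & forall y' x', `|y - y'| < e -> `|x - x'| < e -> A (y', x').
Proof.
rewrite /interior /= => -[[P Q] /= [+ +] PQ].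
move=> /nbhs_ballP[e1 /= e10 P1] /nbhs_ballP[e2 /= e20 Q1].
exists (Num.min e1 e2); first by rewrite lt_min e10.
move=> y' x'; rewrite !lt_min => /andP[h1 _] /andP[_ h2].
by apply: PQ; split; [exact: P1|exact: Q1].
Qed.

(** An interior pair leaves room to lower x by e / 2 within D, whence the strict inequality;
    [regionD_decr] then brings y down to b. *)
Lemma gamma1_lt theta delta b y : 0 < theta < 1 -> 0 < delta -> b <= y ->
  forall x, x <= b -> (regionD theta delta)° (y, x) ->
  (gamma1 theta delta b%:E < x%:E)%E.
Proof.
move=> t01 d0 bY x xb /interior_fst_snd[e e0 He].
rewrite /gamma1 lte_fin; apply: (@le_lt_trans _ _ (x - e / 2)); last first.
  by rewrite ltrBlDr ltrDl divr_gt0.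
have e2 : `|x - (x - e / 2)| < e.
  by rewrite opprB addrC subrK gtr0_norm ?divr_gt0// gtr_pMr// invf_lt1 ?ltr1n.
apply: ge_inf; first by exists 0 => z [_ [+ _]].
apply: (@regionD_decr _ _ _ _ y) => //=; last by apply: He => //; rewrite subrr normr0.
by rewrite (le_trans _ xb)// gerBl ltW// divr_gt0.
Qed.

Lemma le_gamma1 theta delta a b : 0 < theta < 1 -> 0 < delta ->
  a < b -> ~ (regionD theta delta)° (b, a) -> 0 <= b ->
  (a%:E <= gamma1 theta delta b%:E)%E.
Proof.
move=> t01 d0 ab nD b0; rewrite /gamma1 lee_fin; apply: lb_le_inf.
  (* The diagonal point shows that the section is nonempty, at b = 0 too, so that [inf] is a true
     infimum. *)
  exists b; have [b_gt0|] := ltP 0 b.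
    by apply: (@interior_subset _ (regionD theta delta)); exact: interior_regionD_diag.
  move=> b0'; have -> : b = 0 by apply/eqP; rewrite eq_le b0'.
  do 2 split => //=; rewrite (ltW d0)/= subrr normr0 !mul0r sqrtr0 mulr0//.
move=> x Dx; rewrite leNgt; apply/negP => xa; apply: nD.
exact: interior_regionD_lt xa _ _.
Qed.

End Geometry.

(** * Blocks, separating gaps and links *)

Section BlockStructure.
Variable R : realType.
Implicit Types (theta delta x y k b : R) (S E I : set R).

Lemma closed_sup S : closed S -> S !=set0 -> has_ubound S -> S (sup S).
Proof.
by move=> clS S0 ubS; rewrite [X in X _](closure_id S).1//; exact: closure_sup.
Qed.

Lemma closed_inf S : closed S -> S !=set0 -> has_lbound S -> S (inf S).
Proof.
move=> clS S0 lbS; have [s Ss] := S0.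
rewrite [X in X _](closure_id S).1// => B /nbhs_ballP[e /= e0 eB].
have [t St tlt] := inf_adherent e0 (conj S0 lbS).
exists t; split => //; apply: eB; rewrite /ball/= distrC ger0_norm.
  by rewrite ltrBlDl.
by rewrite subr_ge0; exact: ge_inf.
Qed.

Lemma bigcup_blocks theta delta S : S `<=` `[0, +oo[ ->
  \bigcup_(B in blocks theta delta S) B = S.
Proof.
move=> S0; apply/seteqP; split => [x [_ [E _ <-] []//]|x Sx].
set X := `[0, +oo[ `\` \bigcup_(I in separating_gap theta delta S) I.
have Xx : X x.
  split; first exact: S0.
  by move=> [_ [[u _ <-] _]] /connected_component_sub[].
exists (connected_component X x `&` S).
  by exists (connected_component X x) => //; exists x.
by split => //; exact: connected_component_refl.
Qed.

(** Were [[x, y]] free of separating gaps, it would be connected and x, y would share a block. So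
    some separating gap I meets it, and lies within it because I avoids S. An interior link would
    give gamma_1(sup I) < x <= inf I, against separation. *)
Lemma not_linked_blocks theta delta S B1 B2 x y :
  0 < theta < 1 -> 0 < delta ->
  blocks theta delta S B1 -> blocks theta delta S B2 ->
  B1 `&` B2 = set0 -> B1 x -> B2 y -> 0 <= x -> x < y ->
  ~ (regionD theta delta)° (y, x).
Proof.
move=> t01 d0 [_ [u _ <-] <-] [_ [w _ <-] <-].
set X := `[0, +oo[ `\` _ => dB [xB Sx] [yB Sy] x0 xy Dyx.
have [xyX|] := pselect (`[x, y] `<=` X).
  have cxy : connected_component X x y.
    apply: (@connected_component_max _ X `[x, y]) => //.
    - by rewrite /= in_itv/= lexx ltW.
    - by apply/connected_intervalP; exact: interval_is_interval.
    - by rewrite /= in_itv/= lexx ltW.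
  suff : set0 y by [].
  rewrite -dB; split; split => //.
  exact: connected_component_trans cxy.
move=> /existsNP[z /not_implyP[+ Xz]]; rewrite /= in_itv/= => /andP[xz zy].
have [I [[[t Zt <-{I}] gapI] Iz]] : exists I, separating_gap theta delta S I /\ I z.
  apply: contrapT => nI; apply: Xz; split.
    by rewrite /= in_itv/= andbT (le_trans x0).
  by move=> [I gI Iz]; apply: nI; exists I.
move: gapI; set I := connected_component _ t in Iz *.
have IS r : I r -> ~ S r by move=> /connected_component_sub[].
have itvI : is_interval I by apply/connected_intervalP; exact: component_connected.
have xI r : I r -> x <= r.
  move=> Ir; rewrite leNgt; apply/negP => rx; apply: (IS x) => //.
  by apply: (itvI r z) => //; rewrite ltW.
have Iy r : I r -> r <= y.
  move=> Ir; rewrite leNgt; apply/negP => rx; apply: (IS y) => //.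
  by apply: (itvI z r) => //; rewrite zy ltW.
have I0 : I !=set0 by exists z.
have ubI : has_ubound I by exists y.
have lbI : has_lbound I by exists x.
rewrite ereal_sup_EFin// ereal_inf_EFin//; apply/negP; rewrite -ltNge.
apply: (@lt_le_trans _ _ x%:E); last by rewrite lee_fin; exact: lb_le_inf.
apply: (gamma1_lt t01 d0 _ _ Dyx); first exact: ge_sup.
by rewrite (le_trans (xI _ Iz))//; exact: ub_le_sup.
Qed.

Lemma blocks_subsingleton theta delta S B x y : 0 < theta < 1 -> 0 < delta ->
  closed S -> S `<=` `[0, +oo[ ->
  (forall a b, S a -> S b -> 0 < a -> a < b -> ~ (regionD theta delta)° (b, a)) ->
  blocks theta delta S B -> B x -> B y -> ~ x < y.
Proof.
move=> t01 d0 clS S0 nD [_ [u _ <-] <-].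
set X := `[0, +oo[ `\` _ => -[xB Sx] [yB Sy] xy.
have x0 : 0 <= x by have := S0 _ Sx; rewrite /= in_itv/= andbT.
(* A missing point z would lie in a gap whose ends belong to S. The ends being unlinked, the gap
   would be separating, yet the component containing x and y is an interval through z. *)
have SI z : x < z -> z < y -> S z.
  move=> xz zy; apply: contrapT => nSz.
  have Xz : X z.
    apply: (@connected_component_sub _ X u).
    have /connected_intervalP := @component_connected _ X u.
    by apply; [exact: xB|exact: yB|rewrite !ltW].
  case: Xz => _; apply.
  pose A1 := S `&` `]-oo, z]; pose A2 := S `&` `[z, +oo[.
  have A1x : A1 x by split => //=; rewrite in_itv/= ltW.
  have A2y : A2 y by split => //=; rewrite in_itv/= andbT ltW.
  have ub1 : has_ubound A1 by exists z => r [_]; rewrite /= in_itv.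
  have lb2 : has_lbound A2.
    by exists z => r [_]; rewrite /= in_itv/= andbT.
  have [Sa az] : A1 (sup A1).
    apply: closed_sup => //; last by exists x.
    by apply: closedI => //; exact: rray_closed || exact: lray_closed.
  have [Sb bz] : A2 (inf A2).
    apply: closed_inf => //; last by exists y.
    by apply: closedI => //; exact: rray_closed || exact: lray_closed.
  have ax : x <= sup A1 by exact: ub_le_sup.
  set a := sup A1 in Sa az ax; set b := inf A2 in Sb bz.
  have {}az : a < z.
    by rewrite lt_neqAle (itvP az) andbT; apply/eqP => az'; rewrite az' in Sa.
  have {}bz : z < b.
    by rewrite lt_neqAle (itvP bz) andbT; apply/eqP => bz'; rewrite -bz' in Sb.
  have abS r : a < r -> r < b -> ~ S r.
    move=> ar rb Sr; have [rz|zr] := leP r z.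
      suff : r <= a by rewrite leNgt ar.
      by apply: ub_le_sup => //; split => //=; rewrite in_itv.
    suff : b <= r by rewrite leNgt rb.
    by apply: ge_inf => //; split => //=; rewrite in_itv/= andbT ltW.
  have zS : (`[0, +oo[ `\` S) z.
    by split => //=; rewrite in_itv/= andbT (le_trans x0)// ltW.
  exists `]a, b[%classic; last by rewrite /= in_itv/= az.
  have cI : connected_component (`[0, +oo[ `\` S) z = `]a, b[%classic.
    apply/seteqP; split => [r Ir|].
      have itvI : is_interval (connected_component (`[0, +oo[ `\` S) z).
        by apply/connected_intervalP; exact: component_connected.
      have Iz := connected_component_refl zS.
      rewrite /= in_itv/=; apply/andP; split; rewrite ltNge; apply/negP => H.
        have [] // := @connected_component_sub _ _ _ _ (itvI r z Ir Iz a _).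
        by rewrite H ltW.
      have [] // := @connected_component_sub _ _ _ _ (itvI z r Iz Ir b _).
      by rewrite H ltW.
    apply: connected_component_max.
    - by rewrite /= in_itv/= az.
    - move=> r; rewrite /= in_itv/= => /andP[ar rb]; split; last exact: abS.
      by rewrite /= in_itv/= andbT (le_trans x0)// (le_trans ax)// ltW.
    - by apply/connected_intervalP; exact: interval_is_interval.
  have ab : a < b by exact: lt_trans bz.
  split; first by exists z.
  have I0 : `]a, b[%classic !=set0 by exists z; rewrite /= in_itv/= az.
  have ubI : has_ubound `]a, b[%classic.
    by exists b => r; rewrite /= in_itv/= => /andP[_ /ltW].
  have lbI : has_lbound `]a, b[%classic.
    by exists a => r; rewrite /= in_itv/= => /andP[/ltW].
  rewrite ereal_sup_EFin// ereal_inf_EFin// inf_itv ?bnd_simp// sup_itv ?bnd_simp//.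
  have b0 : 0 <= b by rewrite (le_trans (le_trans x0 ax))// ltW.
  have [a0|a0] := ltP 0 a; first by apply: le_gamma1 => //; exact: nD.
  (* For a <= 0 the assumption on pairs says nothing, but gamma_1 is nonnegative; an empty section
     would have [inf] equal to 0. *)
  apply: (@le_trans _ _ 0%E); first by rewrite lee_fin.
  rewrite lee_fin; have [n0|/set0P/negP/negPn/eqP ->] :=
    pselect ([set k' | regionD theta delta (b, k')] !=set0).
    by apply: lb_le_inf => // r [_ []].
  by rewrite inf0.
(* Now S contains all of ]x, y[, so two of its points close enough to the diagonal are linked, a
   contradiction. *)
pose z := (x + y) / 2.
have xz : x < z by rewrite midf_lt.
have zy : z < y by rewrite midf_lt.
have z0 : 0 < z by exact: le_lt_trans xz.
(* The interior is taken twice so that a whole box around (z, z) consists of interior pairs, not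
   merely of points of D. *)
have : (regionD theta delta)°° (z, z).
  rewrite (interior_id _).1; [exact: interior_regionD_diag|exact: open_interior].
move=> /interior_fst_snd[e e0 He].
pose z' := Num.max ((x + z) / 2) (z - e / 2).
have z'z : z' < z.
  by rewrite gt_max midf_lt//= ltrBlDr ltrDl divr_gt0.
have xz' : x < z' by rewrite lt_max midf_lt.
apply: (nD z' z); [apply: SI => //; exact: lt_trans zy|exact: SI| |by []|].
  exact: le_lt_trans xz'.
apply: He; first by rewrite subrr normr0.
rewrite gtr0_norm ?subr_gt0//.
rewrite ltrBlDl -ltrBlDr lt_max; apply/orP; right.
by rewrite ltrD2l ltrN2 gtr_pMr// invf_lt1 ?ltr1n.
Qed.

End BlockStructure.

(** * Comparison of integrals *)

Section IntegralMonotone.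
Import HBNNSimple.

(* The integral of a nonnegative function is a supremum over the simple
   functions below it, so that no measurability is needed, in particular none
   of [Phi] and [calB]. *)
Lemma ge0_le_integral_nomeas d (T : measurableType d) (R : realType)
    (mu : {measure set T -> \bar R}) (D : set T) (f g : T -> \bar R) :
  (forall x, D x -> 0 <= f x)%E -> (forall x, D x -> f x <= g x)%E ->
  (\int[mu]_(x in D) f x <= \int[mu]_(x in D) g x)%E.
Proof.
move=> f0 fg; have g0 x : D x -> (0 <= g x)%E.
  by move=> Dx; exact: le_trans (f0 _ Dx) (fg _ Dx).
rewrite !ge0_integralE//; apply: ereal_sup_le => _ [h hf <-].
exists h => // x.
by apply: le_trans (hf x) _; exact: lee_restrict.
Qed.

End IntegralMonotone.

(** * A positive lower bound for the kernel off the diagonal *)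

Section KernelBound.
Variable R : realType.
Implicit Types (m k K s : R).

Lemma kernel_w_sqr_bounds k k' s : 0 <= k -> 0 <= k' -> -1 <= s <= 1 ->
  (k - k') ^+ 2 <= k ^+ 2 + k' ^+ 2 - 2 * k * k' * s <= (k + k') ^+ 2.
Proof.
move=> k0 k'0 /andP[s0 s1].
have : 0 <= k * k' by rewrite mulr_ge0.
by move=> kk'; apply/andP; split; nra.
Qed.

(** From |k - k'| <= w <= K, the two terms of the exponent are at most m / 2 and K^2 / (8 m), and 1
    / w >= 1 / K; the last factor 2 is the length of [-1, 1]. Off the diagonal w stays positive, so
    the integrand is continuous and hence integrable. The bound depends on the pair only through K,
    so it is uniform near a given pair. *)
Lemma calB_ge m k k' K : 0 < m -> 0 < k -> 0 < k' -> k != k' -> k + k' <= K ->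
  expR (- (m / 2) - K ^+ 2 / (8 * m)) / K * 2 <= calB m k k'.
Proof.
move=> m0 k0 k'0 kk' kK.
have K0 : 0 < K by rewrite (lt_le_trans _ kK)// addr_gt0.
have d0 : 0 < (k - k') ^+ 2 by rewrite exprn_even_gt0//= subr_eq0.
pose Q s := k ^+ 2 + k' ^+ 2 - 2 * k * k' * s.
have Qb s : -1 <= s <= 1 -> (k - k') ^+ 2 <= Q s <= (k + k') ^+ 2.
  by move=> s1; apply: kernel_w_sqr_bounds => //; exact: ltW.
have Q0 s : -1 <= s <= 1 -> 0 < Q s.
  by move=> /Qb/andP[+ _]; exact: lt_le_trans.
have wE s : -1 <= s <= 1 -> kernel_w k k' s ^+ 2 = Q s.
  by move=> s1; rewrite sqr_sqrtr// ltW//; exact: Q0.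
have w0 s : -1 <= s <= 1 -> 0 < kernel_w k k' s.
  by move=> s1; rewrite sqrtr_gt0; exact: Q0.
have cQ : continuous Q.
  move=> s; apply: cvgB; first exact: cvg_cst.
  by apply: cvgM; [exact: cvg_cst|exact: cvg_id].
have cw : continuous (kernel_w k k').
  by move=> s; exact: (continuous_comp (@cQ s) (@sqrt_continuous _ _)).
have cw2 : continuous (fun s => kernel_w k k' s ^+ 2).
  by move=> s; exact: (continuous_comp (@cw s) (@exprn_continuous _ _ _)).
set f := fun s : R => (1 + s ^+ 2) / kernel_w k k' s *
     expR (- (m * (k - k') ^+ 2 / (2 * kernel_w k k' s ^+ 2))
           - kernel_w k k' s ^+ 2 / (8 * m)).
have cf s : -1 <= s <= 1 -> {for s, continuous f}.
  move=> s1; apply: cvgM.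
    apply: cvgM.
      by apply: cvgD; [exact: cvg_cst|exact: exprn_continuous].
    by apply: cvgV; [rewrite gt_eqF//; exact: w0|exact: cw].
  pose h s := - (m * (k - k') ^+ 2 / (2 * kernel_w k k' s ^+ 2))
    - kernel_w k k' s ^+ 2 / (8 * m).
  suff ch : {for s, continuous h}.
    exact: (continuous_comp ch (@continuous_expR _ _)).
  apply: cvgB; last first.
    by apply: cvgM; [exact: cw2|exact: cvg_cst].
  apply: cvgN; apply: cvgM; first exact: cvg_cst.
  apply: cvgV; first by rewrite mulf_neq0// gt_eqF// exprn_gt0// w0.
  by apply: cvgM; [exact: cvg_cst|exact: cw2].
set c := _ / K.
have c0 : 0 <= c by rewrite divr_ge0 ?expR_ge0// ltW.
have fc s : -1 <= s <= 1 -> c <= f s.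
  move=> s1; rewrite /f /c wE// mulrC.
  have wK : kernel_w k k' s <= K.
    apply: le_trans kK; rewrite -ler_sqr ?nnegrE ?addr_ge0 ?(ltW k0) ?(ltW k'0)//.
      by rewrite wE//; case/andP: (Qb _ s1).
    exact/ltW/w0.
  apply: ler_pM; rewrite ?expR_ge0 ?invr_ge0 ?(ltW K0)//.
    rewrite -[leLHS]mul1r; apply: ler_pM; rewrite ?ler01 ?invr_ge0 ?(ltW K0)//.
      by rewrite lerDl sqr_ge0.
    by rewrite lef_pV2// posrE// w0.
  rewrite ler_expR lerD// lerN2.
    rewrite ler_pdivrMr ?mulr_gt0 ?Q0//.
    by have /andP[h _] := Qb _ s1; rewrite [leRHS]mulrA divfK// ler_pM2l.
  rewrite ler_pM2r ?invr_gt0 ?mulr_gt0//.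
  have /andP[_ /le_trans ->]// := Qb _ s1.
  by rewrite ler_sqr ?nnegrE ?(ltW K0)// addr_ge0// ltW.
have fine2 : fine (lebesgue_measure (`[-1, 1]%classic : set R)) = 2.
  rewrite lebesgue_measure_itv/= lte_fin ifT; last by rewrite (lt_trans (ltrN10 _)).
  by rewrite -EFinD/= opprK.
have cst_int : lebesgue_measure.-integrable `[-1, 1] (EFin \o (fun=> c)).
  apply: continuous_compact_integrable; first exact: segment_compact.
  by apply: continuous_subspaceT => ?; exact: cvg_cst.
have f_int : lebesgue_measure.-integrable `[-1, 1] (EFin \o f).
  apply: continuous_compact_integrable; first exact: segment_compact.
  apply: continuous_in_subspaceT => s; rewrite inE/= in_itv/= => s1.
  exact: cf.
rewrite -[leLHS]mul1r; apply: ler_pM => //; first by rewrite mulr_ge0.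
  by rewrite -expR0 ler_expR divr_ge0// addr_ge0// ltW.
have -> : c * 2 = \int[lebesgue_measure]_(s in `[-1, 1]) c.
  by rewrite Rintegral_cst// fine2.
apply: le_Rintegral => // s; rewrite /= in_itv/=; exact: fc.
Qed.

End KernelBound.

(** * Support of a finite measure *)

Section Support.
Variable R : realType.
Notation fmeasure := {finite_measure set (measurableTypeR R) -> \bar R}.
Implicit Types (v : fmeasure).

Lemma closed_supp v : closed (supp v).
Proof.
rewrite -openC openE => x nSx.
have [U [oU Ux vU0]] : exists U : set R, [/\ open U, U x & v U = 0%E].
  move/existsNP : nSx => [U /not_implyP[oU /not_implyP[Ux vU]]].
  exists U; split => //; apply/eqP; rewrite eq_le measure_ge0 andbT leNgt.
  exact/negP.
rewrite /interior; apply: filterS (open_nbhs_nbhs (conj oU Ux)) => y Uy Sy.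
by have := Sy U oU Uy; rewrite vU0 ltxx.
Qed.

Lemma measurable_supp v : measurable (supp v : set (measurableTypeR R)).
Proof. by apply: closed_measurable; exact: closed_supp. Qed.

(** Every point outside the support lies in a null ball with rational centre and radius, and these
    balls are countably many. *)
Lemma measure_setC_supp v : v (~` supp v) = 0%E.
Proof.
apply: measure_negligible.
  by apply: measurableC; exact: measurable_supp.
pose B (p : rat * rat) : set (measurableTypeR R) := ball (ratr p.1 : R) (ratr p.2).
have mB p : measurable (B p).
  by rewrite /B ball_itv; exact: measurable_itv.
pose F n : set (measurableTypeR R) := if (unpickle n : option (rat * rat)) is Some p then
  (if v (B p) == 0%E then B p else set0) else set0.
apply: (negligibleS (A := \bigcup_n F n)); last first.
  apply: negligible_bigcup => n; rewrite /F.
  case: unpickle => [p|]; last exact: negligible_set0.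
  case: ifPn => [/eqP v0|_]; last exact: negligible_set0.
  by apply/negligibleP => //; exact: mB.
move=> x nSx.
have [U [oU Ux vU0]] : exists U : set R, [/\ open U, U x & v U = 0%E].
  move/existsNP : nSx => [U /not_implyP[oU /not_implyP[Ux vU]]].
  exists U; split => //; apply/eqP; rewrite eq_le measure_ge0 andbT leNgt.
  exact/negP.
have [c [r /= []]] := open_subball_rat oU (mem_set Ux); rewrite inE => Bx BU.
exists (pickle (c, r)); first by [].
rewrite /F pickleK ifT; first exact: Bx.
apply/eqP; apply: (@subset_measure0 _ _ _ v _ U) => //.
exact: open_measurable.
Qed.

Lemma supp_halfline v : on_halfline v -> supp v `<=` `[0, +oo[.
Proof.
move=> v0 x Sx; rewrite /= in_itv/= andbT leNgt; apply/negP => x0.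
have := Sx `]-oo, 0[%classic (@lray_open _ R 0); rewrite v0 ltxx /= in_itv/=.
by move=> /(_ x0).
Qed.

Lemma measureI_full v (A D : set R) : measurable A -> measurable D ->
  v (~` D) = 0%E -> v (A `&` D) = v A.
Proof.
move=> mA mD v0; rewrite [RHS](measureDI v mA mD).
rewrite [X in (X + _)%E](_ : _ = 0%E) ?add0e//.
apply: (@subset_measure0 _ _ _ v _ (~` D)) => //.
- by apply: measurableD.
- exact: measurableC.
Qed.

End Support.

(** * The family [calF] and atomic sums *)

Section Family.
Variable R : realType.
Notation fmeasure := {finite_measure set (measurableTypeR R) -> \bar R}.
Variables (theta delta alpha : R) (J : set nat) (C : nat -> set R) (M : nat -> R).
Hypothesis hC : forall n, J n -> closed (C n) /\ C n `<=` `[0, +oo[.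
Hypothesis hdisj : trivIset J C.
Hypothesis hM : forall n, J n -> 0 < M n.
Implicit Type v w : fmeasure.

Lemma measurable_block n : J n -> measurable (C n : set (measurableTypeR R)).
Proof. by move=> /hC[clC _]; exact: closed_measurable. Qed.

Lemma calF_bigcup v : calF theta delta J C M alpha v ->
  \bigcup_(n in J) C n = supp v.
Proof.
move=> [v0 _ CE _]; rewrite -(bigcup_blocks theta delta (supp_halfline v0)) -CE.
by rewrite bigcup_image.
Qed.

(** The positive mass M n makes the block nonempty; closedness does the rest. *)
Lemma calF_min v n : calF theta delta J C M alpha v -> J n -> C n (inf (C n)).
Proof.
move=> [_ _ _ vC] Jn; have [clC C0] := hC Jn.
apply: closed_inf => //; last by exists 0 => x /C0/=; rewrite in_itv/= andbT.
apply/set0P/eqP => Cn0; have := vC _ Jn; rewrite Cn0 measure0 => -[M0].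
by have := hM Jn; rewrite -M0 ltxx.
Qed.

Lemma calF_setC v : calF theta delta J C M alpha v ->
  v (~` \bigcup_(n in J) C n) = 0%E.
Proof. by move=> Fv; rewrite (calF_bigcup Fv) measure_setC_supp. Qed.

Lemma measurable_blocks :
  measurable (\bigcup_(n in J) C n : set (measurableTypeR R)).
Proof. by apply: bigcup_measurable => n; exact: measurable_block. Qed.

(** Membership in [calF] already fixes the mass of each block and leaves none outside the blocks.
    Only the distribution within a block remains to be compared. *)
Lemma atomic_sumP v : calF theta delta J C M alpha v ->
  is_atomic_sum J C M v <->
  forall n, J n -> v (C n `\ inf (C n)) = 0%E.
Proof.
move=> Fv; have [_ _ _ vC] := Fv; split => [vA n Jn|v0 A mA].
  rewrite vA; last by apply: measurableD => //; exact: measurable_block.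
  apply: eseries0 => i _ /[!inE] Ji; rewrite diracE memNset ?mule0//.
  move=> -[Cni ne]; apply: ne => /=.
  (* By disjointness the only atom that could charge C n is its own minimum, which has been
     removed. *)
  have ni : n = i by apply: (hdisj Jn Ji); exists (inf (C i)); split => //; exact: calF_min Fv Ji.
  by rewrite ni.
rewrite -(measureI_full mA measurable_blocks (calF_setC Fv)) setI_bigcupr.
rewrite measure_bigcup; last 2 first.
- by move=> n Jn; apply: measurableI => //; exact: measurable_block.
- exact: trivIset_setIl.
apply: eq_eseriesr => n /[!inE] Jn.
have mCn := measurable_block Jn.
have [iA|iA] := pselect (A (inf (C n))).
  rewrite diracE mem_set// mule1 -vC// setIC.
  rewrite [RHS](measureDI v mCn mA).
  rewrite [X in (X + _)%E](_ : _ = 0%E) ?add0e//.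
  apply: (@subset_measure0 _ _ _ v _ (C n `\ inf (C n))) => //.
  - exact: measurableD.
  - exact: measurableD.
  - by move=> x [Cx nAx]; split => //= xi; apply: nAx; rewrite xi.
  - exact: v0.
rewrite diracE memNset// mule0.
apply: (@subset_measure0 _ _ _ v _ (C n `\ inf (C n))) => //.
- exact: measurableI.
- exact: measurableD.
- by move=> x [Ax Cx]; split => //= xi; apply: iA; rewrite -xi.
- exact: v0.
Qed.

End Family.

(** * Zero dissipation and links *)

Section Dissipation.
Variables (R : realType) (m theta delta alpha : R) (Phi : R * R -> R).
Hypothesis hm : 0 < m.
Hypotheses (hPhi : cutoff m theta delta Phi) (halpha : 0 < alpha).
Notation fmeasure := {finite_measure set (measurableTypeR R) -> \bar R}.
Implicit Types (v : fmeasure) (x y : R).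

(** The exponentials are exchanged with respect to [dissipation]: the opposite of the integrand,
    nonnegative on positive pairs. *)
Definition dissipation_density (p : R * R) : R :=
  Phi p * calB m p.1 p.2 / (p.1 * p.2)
  * (expR (- p.2) - expR (- p.1)) * (p.1 `^ alpha - p.2 `^ alpha).

Lemma quadrant_star_gt0 x y : 0 < x -> 0 < y -> quadrant_star (x, y).
Proof.
move=> x0 y0; rewrite /quadrant_star/= !ltW//; split => //; split => //.
by apply/eqP => -[x00 _]; rewrite x00 ltxx in x0.
Qed.

Lemma nbhs_quadrant_star x y : 0 < x -> 0 < y -> nbhs (x, y) (@quadrant_star R).
Proof.
move=> x0 y0; exists ([set z | 0 < z], [set z | 0 < z]) => /=.
  by split; exact: lt_nbhsr.
by move=> [a b] [/= a0 b0]; exact: quadrant_star_gt0.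
Qed.

Lemma cutoff_continuous_at x y : 0 < x -> 0 < y -> {for (x, y), continuous Phi}.
Proof.
move=> x0 y0.
have /subspace_continuousP/(_ _ (quadrant_star_gt0 x0 y0)) := cutoff_continuous hPhi.
by rewrite within_interior//; exact: nbhs_quadrant_star.
Qed.

(** A converse of [cutoff_neq0] at positive pairs: by continuity [Phi] is nonzero on a
    neighbourhood, which is then contained in its support D. *)
Lemma interior_regionD_cutoff x y : 0 < x -> 0 < y -> Phi (x, y) != 0 ->
  (regionD theta delta)° (x, y).
Proof.
move=> x0 y0 P0; rewrite -(cutoff_supp hPhi).
have h : \forall p \near (x, y), Phi p != 0.
  exact: (cvgr_neq0 _ (cutoff_continuous_at x0 y0) P0).
apply: filterS2 h (nbhs_quadrant_star x0 y0) => p Pp qp.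
by apply: subset_closure.
Qed.

Lemma dissipation_density_ge0 p :
  (`]0, +oo[ `*` `]0, +oo[)%classic p -> 0 <= dissipation_density p.
Proof.
case: p => x y [/=]; rewrite !in_itv/= !andbT => x0 y0.
rewrite /dissipation_density/= -mulrA mulr_ge0//.
  apply: divr_ge0; last by rewrite mulr_ge0// ltW.
  exact: (cutoff_ge0 hPhi (quadrant_star_gt0 x0 y0)).
have [xy|xy] := leP x y.
  rewrite -mulrNN mulr_ge0// oppr_ge0 subr_le0.
    by rewrite ler_expR lerN2.
  by rewrite ge0_ler_powR// ?nnegrE ltW.
rewrite mulr_ge0// subr_ge0.
  by rewrite ler_expR lerN2 ltW.
by rewrite ge0_ler_powR// ?nnegrE ltW.
Qed.

Lemma dissipationE v : dissipation m Phi alpha v =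
  (- \int[(v \x v)%E]_(p in `]0%R, +oo[ `*` `]0%R, +oo[)
     (dissipation_density p)%:E)%E.
Proof.
rewrite -integral_ge0N.
  by apply: eq_integral => p _; rewrite -EFinN; congr (_%:E);
    rewrite /dissipation_density; ring.
by move=> p Dp; rewrite lee_fin dissipation_density_ge0.
Qed.

(** A positive pair in K x K is either diagonal, where the differences vanish, or unlinked, where
    [Phi] vanishes. The other pairs form a null set. *)
Lemma dissipation_eq0 v (K : set R) : measurable K -> v (~` K) = 0%E ->
  (forall x y, K x -> K y -> 0 < x -> x < y -> ~ (regionD theta delta)° (y, x)) ->
  dissipation m Phi alpha v = 0%E.
Proof.
move=> mK vK nD; rewrite dissipationE; apply/eqP; rewrite oppe_eq0.
rewrite eq_le integral_ge0 ?andbT//; last first.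
  by move=> p Dp; rewrite lee_fin dissipation_density_ge0.
set D := `]0%R, +oo[ `*` `]0%R, +oo[.
pose N := (~` K `*` setT) `|` (setT `*` ~` K) : set (measurableTypeR R * measurableTypeR R).
have mD : measurable (D : set (measurableTypeR R * measurableTypeR R)).
  by apply: measurableX; exact: measurable_itv.
have mN1 : measurable (~` K `*` setT : set (measurableTypeR R * measurableTypeR R)).
  by apply: measurableX => //; exact: measurableC.
have mN2 : measurable (setT `*` ~` K : set (measurableTypeR R * measurableTypeR R)).
  by apply: measurableX => //; exact: measurableC.
have mN : measurable N by exact: measurableU.
have N0 : ((v \x v) (D `&` N) = 0)%E.
  apply: (@subset_measure0 _ _ _ _ _ N) => //; first exact: measurableI.
  have N2 : ((v \x v) (setT `*` ~` K) = 0)%E.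
    by rewrite product_measure1E//; [rewrite [X in (_ * X)%E]vK mule0|exact: measurableC].
  have N1 : ((v \x v) (~` K `*` setT) = 0)%E.
    by rewrite product_measure1E//; [rewrite [X in (X * _)%E]vK mul0e|exact: measurableC].
  exact: (eq_trans (measureU0 mN1 mN2 N2) N1).
(* The measurable majorant is infinite on the null set N and 0 elsewhere; its integral is +oo * 0 =
   0. *)
apply: (@le_trans _ _ (\int[(v \x v)%E]_(p in D) ((cst +oo%E \_ N) p))%E).
  apply: ge0_le_integral_nomeas => -[x y] [/=]; rewrite !in_itv/= !andbT => x0 y0.
    by rewrite lee_fin dissipation_density_ge0//; split; rewrite /= in_itv/= andbT.
  rewrite patchE; case: ifPn => [_|]; first by rewrite leey.
  rewrite notin_setE => /not_orP[/= /not_andP[/contrapT Kx|//] /not_andP[//|/contrapT Ky]].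
  rewrite lee_fin /dissipation_density/=.
  have [xy|xy|<-] := ltgtP x y; last by rewrite !subrr !mulr0.
  - rewrite (_ : Phi (x, y) = 0) ?mul0r//.
    rewrite (cutoff_sym hPhi) //; last exact: quadrant_star_gt0.
    by apply/eqP/negPn/negP => /(interior_regionD_cutoff y0 x0); exact: nD.
  - rewrite (_ : Phi (x, y) = 0) ?mul0r//.
    by apply/eqP/negPn/negP => /(interior_regionD_cutoff x0 y0); exact: nD.
rewrite -integral_mkcondr integral_cst; last exact: measurableI.
by rewrite [X in (_ * X)%E]N0 mule0.
Qed.

Lemma dissipation_eq0_not_linked v a b : dissipation m Phi alpha v = 0%E ->
  supp v a -> supp v b -> 0 < a -> a < b -> ~ (regionD theta delta)° (b, a).
Proof.
move=> /eqP; rewrite dissipationE oppe_eq0 => /eqP v0 Sa Sb a0 ab Dba.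
have b0 : 0 < b by exact: lt_trans ab.
(* A quarter of the distance leaves the fixed gap ]a1, b1[ between the eta-balls around a and b, so
   both differences in the density stay away from 0. *)
pose eta := (b - a) / 4; pose a1 := a + eta; pose b1 := b - eta.
have eta0 : 0 < eta by rewrite divr_gt0// subr_gt0.
have ab1 : a1 < b1 by rewrite /a1 /b1 /eta; lra.
have a10 : 0 < a1 by rewrite addr_gt0.
have b10 : 0 < b1 by exact: lt_trans ab1.
(* This is the bound of [calB_ge] with K = 2b + b, valid for x < 2b and y < b. *)
pose c1 := expR (- (m / 2) - (2 * b + b) ^+ 2 / (8 * m)) / (2 * b + b) * 2.
have c10 : 0 < c1 by rewrite /c1 mulr_gt0// divr_gt0 ?expR_gt0// addr_gt0// mulr_gt0.
have calB_c1 x y : 0 < x -> 0 < y -> y < b -> x < 2 * b -> y < x -> c1 <= calB m x y.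
  move=> x0 y0 yb xb yx; apply: calB_ge => //; first by rewrite gt_eqF.
  by rewrite lerD// ltW.
(* [cutoff_ge0] gives the sign of the product [Phi * calB] only; positivity of [calB] transfers it
   to [Phi], and [cutoff_neq0] excludes 0. *)
have P0 : 0 < Phi (b, a).
  have := cutoff_ge0 hPhi (quadrant_star_gt0 b0 a0).
  rewrite /cutB pmulr_lge0; first by rewrite le_eqVlt eq_sym (negbTE (cutoff_neq0 hPhi Dba)).
  by apply: (lt_le_trans c10); apply: calB_c1 => //; lra.
have /interior_fst_snd[e e0 He] : [set p | Phi (b, a) / 2 < Phi p]° (b, a).
  rewrite /interior/=; near=> p; rewrite /=; near: p.
  apply: cvgr_gt; first exact: (cutoff_continuous_at b0 a0).
  by rewrite ltr_pdivrMr// ltr_pMr// ltr1n.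
(* The radius e keeps [Phi] above half its value at (b, a), eta separates the balls, and a keeps the
   lower ball among positive numbers. *)
pose r := Num.min e (Num.min eta a).
have r0 : 0 < r by rewrite !lt_min e0 eta0.
pose U : set R := ball b r; pose V : set R := ball a r.
have mU : measurable (U : set (measurableTypeR R)).
  by rewrite /U ball_itv; exact: measurable_itv.
have mV : measurable (V : set (measurableTypeR R)).
  by rewrite /V ball_itv; exact: measurable_itv.
have vU : (0 < v U)%E by apply: Sb; [exact: ball_open|exact: ballxx].
have vV : (0 < v V)%E by apply: Sa; [exact: ball_open|exact: ballxx].
pose D : set (R * R) := `]0%R, +oo[ `*` `]0%R, +oo[.
pose c := Phi (b, a) / 2 * c1 / (2 * b * b) * (expR (- a1) - expR (- b1))
   * (b1 `^ alpha - a1 `^ alpha).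
have ea : 0 < expR (- a1) - expR (- b1).
  by rewrite subr_gt0 ltr_expR ltrN2.
have pa : 0 < b1 `^ alpha - a1 `^ alpha.
  by rewrite subr_gt0 gt0_ltr_powR// nnegrE ltW.
have c0 : 0 < c.
  have q0 : 0 < 2 * b * b by rewrite mulr_gt0// mulr_gt0.
  rewrite /c; apply: mulr_gt0 => //; apply: mulr_gt0 => //.
  by apply: mulr_gt0; rewrite ?invr_gt0//; apply: mulr_gt0 => //; rewrite divr_gt0.
have UV x y : U x -> V y -> [/\ 0 < x, 0 < y & c <= dissipation_density (x, y)].
  rewrite /U /V /= /ball/= => bx ay.
  have [bxe bxeta] : `|b - x| < e /\ `|b - x| < eta.
    by move: bx; rewrite !lt_min => /and3P[].
  have [aye ayeta aya] : [/\ `|a - y| < e, `|a - y| < eta & `|a - y| < a].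
    by move: ay; rewrite !lt_min => /and3P[].
  have Pxy := He _ _ bxe aye.
  move: bxeta ayeta aya; rewrite !ltr_norml => /andP[x1 x2] /andP[y1 y2] /andP[_ y3].
  have y0 : 0 < y by lra.
  have ya1 : y < a1 by rewrite /a1; lra.
  have xb1 : b1 < x by rewrite /b1; lra.
  have x0 : 0 < x by lra.
  have xb : x < 2 * b by move: x1; rewrite /eta; lra.
  have yb : y < b by move: ya1; rewrite /a1 /eta; lra.
  split => //; rewrite /c /dissipation_density/=.
  have g1 : 0 <= Phi (b, a) / 2 by rewrite divr_ge0// ltW.
  have g2 : 0 <= Phi (b, a) / 2 * c1 by rewrite mulr_ge0// ltW.
  have g3 : 0 <= (2 * b * b)^-1 by rewrite invr_ge0 !mulr_ge0// ltW.
  have g4 : 0 <= Phi (b, a) / 2 * c1 / (2 * b * b) by rewrite mulr_ge0.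
  have g5 : 0 <= Phi (b, a) / 2 * c1 / (2 * b * b) * (expR (- a1) - expR (- b1)).
    by rewrite mulr_ge0// ltW.
  apply: ler_pM (ltW pa) _ _ => //.
    apply: ler_pM (ltW ea) _ _ => //.
      apply: ler_pM => //.
        apply: ler_pM (ltW c10) (ltW Pxy) _ => //.
        by apply: calB_c1 => //; lra.
      rewrite lef_pV2 ?posrE ?mulr_gt0//.
      by apply: ler_pM; exact: ltW.
    by apply: lerB; rewrite ler_expR lerN2 ltW.
  by apply: lerB; rewrite ge0_ler_powR// ?nnegrE ltW.
have mUV : ((v \x v) (U `*` V) = v U * v V)%E by rewrite product_measure1E.
have : (0 < \int[(v \x v)%E]_(p in D) (dissipation_density p)%:E)%E.
  apply: (@lt_le_trans _ _ (\int[(v \x v)%E]_(p in D) ((cst c%:E \_ (U `*` V)) p))%E).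
    rewrite -integral_mkcondr (_ : D `&` _ = U `*` V); last first.
      apply: setIidr => -[x y] [/= Ux Vy]; have [x0 y0 _] := UV _ _ Ux Vy.
      by split; rewrite /= in_itv/= andbT.
    rewrite integral_cst; last exact: measurableX.
    by rewrite mule_gt0 ?lte_fin// [X in (_ < X)%E]mUV mule_gt0.
  apply: ge0_le_integral_nomeas => -[x y] Dxy.
    by rewrite patchE; case: ifPn => // _; rewrite lee_fin ltW.
  rewrite patchE; case: ifPn => [/[!inE] -[/= Ux Vy]|_].
    by rewrite lee_fin; have [] := UV _ _ Ux Vy.
  by rewrite lee_fin dissipation_density_ge0.
by rewrite v0 ltxx.
Unshelve. all: by end_near. Qed.

End Dissipation.

(** Builds the competitor of [minimal_moment_null]: one half of v stays in place and preserves the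
    support, the other half is moved by T. *)
Lemma average_pushforward d (X : measurableType d) (R : realType)
    (v : {finite_measure set X -> \bar R}) (T : X -> X) :
  measurable_fun setT T ->
  exists w : {finite_measure set X -> \bar R},
  (forall A, measurable A -> w A = (2^-1)%:E * (v A + v (T @^-1` A)))%E /\
  (forall D (f : X -> \bar R), measurable D -> measurable_fun D f ->
    (forall x, 0 <= f x)%E ->
   \int[w]_(x in D) f x =
     (2^-1)%:E * (\int[v]_(x in D) f x + \int[v]_(x in T @^-1` D) f (T x)))%E.
Proof.
move=> mT.
pose vT : {measure set X -> \bar R} :=
  measure_function_pushforward__canonical__measure_function_Measure v mT.
have half0 : (0 : R) <= 2^-1 by rewrite invr_ge0.
pose w0 : {measure set X -> \bar R} :=
  mscale (NngNum half0) (measure_add v vT).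
have w0E A : measurable A -> w0 A = ((2^-1)%:E * (v A + v (T @^-1` A)))%E.
  move=> mA; rewrite -[LHS]/(mscale (NngNum half0) (measure_add v vT) A).
  by congr (_ * _)%E; exact: measure_addE.
have fin_w0 : fin_num_fun w0.
  move=> A mA; rewrite w0E// fin_numM// fin_numD !fin_num_measure//.
  by have := mT measurableT _ mA; rewrite setTI.
pose fw := @Measure_isFinite.Build _ _ R w0 fin_w0.
pose w : {finite_measure set X -> \bar R} := HB.pack (Measure.sort w0) fw.
exists w; split => [A mA|D f mD mf f0]; first exact: w0E.
rewrite (@eq_measure_integral _ _ _ _ w0)//.
rewrite ge0_integral_mscale//=; congr (_ * _)%E.
rewrite ge0_integral_measure_add//; congr (_ + _)%E.
by rewrite ge0_integral_pushforward.
Qed.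


(** * Minimality of the moment *)

Section Moment.
Variable R : realType.
Notation fmeasure := {finite_measure set (measurableTypeR R) -> \bar R}.
Variables (theta delta alpha : R) (J : set nat) (C : nat -> set R) (M : nat -> R).
Hypothesis halpha : 0 < alpha.
Hypothesis hC : forall n, J n -> closed (C n) /\ C n `<=` `[0, +oo[.
Hypothesis hdisj : trivIset J C.
Hypothesis hM : forall n, J n -> 0 < M n.
Implicit Type v w : fmeasure.
Local Notation F := (calF theta delta J C M alpha).

Let pw (k : measurableTypeR R) : \bar R := (k `^ alpha)%:E.

Let mpw D : measurable_fun D pw.
Proof.
by apply: measurable_funTS; apply/measurable_EFinP; exact: measurable_powR.
Qed.

Let pw_ge0 k : (0 <= pw k)%E.
Proof. by rewrite lee_fin powR_ge0. Qed.

Let Cx n := if n \in J then C n else set0.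

Lemma moment_sum v : F v ->
  moment alpha v = (\sum_(n <oo) \int[v]_(k in Cx n) (k `^ alpha)%:E)%E.
Proof.
move=> Fv.
have mCx n : measurable (Cx n : set (measurableTypeR R)).
  by rewrite /Cx; case: ifPn => // /[!inE] Jn; exact: measurable_block hC _ Jn.
have CxE : \bigcup_n Cx n = \bigcup_(n in J) C n by rewrite [RHS]bigcup_mkcond.
rewrite -ge0_integral_bigcup//; last first.
  by apply/(trivIset_mkcond J C).
  by move=> x _; exact: pw_ge0.
rewrite /moment CxE.
have mU : measurable (~` \bigcup_(n in J) C n : set (measurableTypeR R)).
  by apply: measurableC; exact: (measurable_blocks hC).
have U0 : v (~` \bigcup_(n in J) C n) = 0%E by exact: (calF_setC Fv).
have mI : measurable (`[0, +oo[%classic : set (measurableTypeR R)).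
  exact: measurable_itv.
apply: (eq_trans (ge0_negligible_integral mU mI (@mpw _) (fun x _ => pw_ge0 x) U0)).

rewrite setDE setCK setIidr// => x [n Jn Cnx].
by have [_] := hC Jn; exact.
Qed.

Lemma null_moment_le v w : F v ->
  (forall n, J n -> v (C n `\ inf (C n)) = 0%E) -> F w ->
  (moment alpha v <= moment alpha w)%E.
Proof.
move=> Fv v0 Fw; rewrite !moment_sum//.
apply: lee_nneseries => [n _ _|n _].
  by apply: integral_ge0 => x _; exact: pw_ge0.
rewrite /Cx; case: ifPn => [|_]; last by rewrite !integral_set0.
rewrite inE => Jn.
have mCn : measurable (C n : set (measurableTypeR R)) by exact: measurable_block hC _ Jn.
have [_ _ _ vC] := Fv; have [_ _ _ wC] := Fw.
have lbC x : C n x -> 0 <= inf (C n) <= x.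
  move=> Cx'; have [_ C0] := hC Jn.
  have lb0 : lbound (C n) 0 by move=> y /C0; rewrite /= in_itv/= andbT.
  by rewrite lb_le_inf//; [apply: ge_inf => //; exists 0|exists x].
apply: (@le_trans _ _ (\int[v]_(k in C n) cst (inf (C n) `^ alpha)%:E k)%E).
  rewrite le_eqVlt; apply/orP; left; apply/eqP; apply: ae_eq_integral => //.
  exists (C n `\ inf (C n)); split; [exact: measurableD|exact: v0|].
  move=> x /= /not_implyP[Cnx ne]; split => //= xi; apply: ne; rewrite xi//.
(* Both measures give C n the mass M n, so the constant has the same integral against v and w. *)
rewrite integral_cst// [X in (_ * X)%E](vC _ Jn) -[X in (_ * X)%E](wC _ Jn).
rewrite -integral_cst//.
apply: ge0_le_integral_nomeas.
  by move=> x _; rewrite lee_fin powR_ge0.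
move=> x /lbC/andP[i0 ix]; rewrite lee_fin ge0_ler_powR// ?nnegrE//.
  exact: ltW.
exact: le_trans ix.
Qed.

(* The sum of Dirac masses itself need not lie in [calF], its support being
   possibly smaller than the union of the blocks. The competitor is the average
   of [v] and of its image under the map collapsing [C n] onto its minimum. *)
Lemma minimal_moment_null v : F v ->
  (forall w, F w -> (moment alpha v <= moment alpha w)%E) ->
  forall n, J n -> v (C n `\ inf (C n)) = 0%E.
Proof.
move=> Fv minv n Jn.
have [v0 mv Cv vC] := Fv.
have mCn : measurable (C n : set (measurableTypeR R)) by exact: measurable_block hC _ Jn.
have [_ C0] := hC Jn; set k := inf (C n).
have Ck : C n k by exact: (calF_min hC hM Fv Jn).
have k0 : 0 <= k by have := C0 _ Ck; rewrite /= in_itv/= andbT.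
have Ckle x : C n x -> k <= x.
  by move=> Cnx; apply: ge_inf => //; exists 0 => y /C0; rewrite /= in_itv/= andbT.
have CS x : C n x -> supp v x by rewrite -(calF_bigcup Fv) => ?; exists n.
pose T (x : measurableTypeR R) : measurableTypeR R := if x \in C n then k else x.
have TC x : C n x -> T x = k by move=> Cnx; rewrite /T mem_set.
have TnC x : ~ C n x -> T x = x by move=> Cnx; rewrite /T memNset.
have mT : measurable_fun setT T.
  apply: measurable_fun_ifT => //.
  apply: (measurable_fun_bool true); rewrite setTI.
  rewrite (_ : _ @^-1` _ = C n)//.
  by apply/seteqP; split => x /=; [move=> xC; exact: set_mem|exact: mem_set].
have [w [wE iwE]] := average_pushforward v mT.
(* The half-lines, all the blocks and the complement of the support either contain C n or avoid it.
   Being T-invariant, they keep their v-measure under w, which is how w gets into [calF]. *)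
have TE (A : set R) : C n `<=` A \/ C n `<=` ~` A -> T @^-1` A = A.
  move=> CA; apply/seteqP; split => x /=;
    (have [Cnx|Cnx] := pselect (C n x); [rewrite (TC _ Cnx)|by rewrite TnC]);
    case: CA => CA.
  - by move=> _; exact: CA.
  - by move=> /(CA _ Ck).
  - by move=> _; exact: CA.
  - by move=> /(CA _ Cnx).
have half (x : \bar R) : x \is a fin_num -> ((2^-1)%:E * (x + x) = x)%E.
  by move=> xf; rewrite -(fineK xf) -EFinD -EFinM; congr (_%:E); field.
have neg x : C n x -> ~ x < 0 by move=> /C0; rewrite /= in_itv/= andbT leNgt => /negP.
have suppw : supp w = supp v.
  apply/seteqP; split => x Sx; last first.
    move=> U oU Ux; rewrite wE; last exact: open_measurable.
    rewrite mule_gt0// ?lte_fin ?invr_gt0// (lt_le_trans (Sx U oU Ux))// leeDl//.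
  apply: contrapT => nSx.
  have := Sx (~` supp v) (closed_openC (@closed_supp _ v)) nSx.
  have mS : measurable (~` supp v : set (measurableTypeR R)).
    by apply: measurableC; exact: measurable_supp.
  rewrite wE// TE ?measure_setC_supp ?adde0 ?mule0 ?ltxx//.
  by right; rewrite setCK => y /CS.
pose D : set (measurableTypeR R) := `[0, +oo[%classic.
have mD : measurable D by exact: measurable_itv.
have TD : T @^-1` D = D.
  by apply: TE; left.
pose I := (\int[v]_(x in D) pw (T x))%E.
have momentw : moment alpha w = ((2^-1)%:E * (moment alpha v + I))%E.
  rewrite /moment (iwE _ pw mD (@mpw _) pw_ge0) TD//.
have mpT : measurable_fun D (pw \o T).
  by apply: measurable_funTS; exact: (measurableT_comp (@mpw setT) mT).
have Tle x : D x -> 0 <= T x <= x.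
  rewrite /D/= in_itv/= andbT => x0; have [Cnx|Cnx] := pselect (C n x).
    by rewrite TC// k0 Ckle.
  by rewrite TnC// x0 lexx.
have I_le : (I <= moment alpha v)%E.
  apply: ge0_le_integral_nomeas => x Dx; first exact: pw_ge0.
  have /andP[Tx0 Txx] := Tle _ Dx.
  rewrite lee_fin ge0_ler_powR ?nnegrE//; first exact: ltW.
  exact: le_trans Txx.
have I0 : (0 <= I)%E by apply: integral_ge0 => x _; exact: pw_ge0.
have mv0 : (0 <= moment alpha v)%E by apply: integral_ge0 => x _; exact: pw_ge0.
have If : I \is a fin_num by rewrite ge0_fin_numE// (le_lt_trans I_le).
have mvf : moment alpha v \is a fin_num by rewrite ge0_fin_numE.
have Fw : F w.
  split.
  - rewrite /on_halfline wE//.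
    rewrite TE ?v0 ?adde0 ?mule0//.
    by right => y /neg ny; rewrite /= in_itv.
  - rewrite momentw.
    rewrite -(fineK mvf) -(fineK If) -EFinD -EFinM.
    exact: ltry.
  - by rewrite suppw.
  - move=> j Jj; have mCj := measurable_block hC Jj.
    rewrite wE// TE; first by rewrite vC// half.
    have [<-|nj] := eqVneq n j; first by left.
    right => y Cy Cjy; move/eqP: nj; apply; apply: (hdisj Jn Jj); exists y; split => //.
(* Minimality reads M(v) <= (M(v) + I) / 2, and both terms are finite. *)
have momentv_le : (moment alpha v <= I)%E.
  have := minv _ Fw; rewrite momentw -(fineK mvf) -(fineK If) -EFinD -EFinM !lee_fin.
  by move=> h; lra.
(* The loss of moment under the collapse: nonnegative, of integral zero by the last inequality, and
   positive on C n away from its minimum, which is therefore a null set. *)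
pose g (x : measurableTypeR R) : \bar R := (x `^ alpha - T x `^ alpha)%:E.
have g0 x : D x -> (0 <= g x)%E.
  move=> Dx; have /andP[Tx0 Txx] := Tle _ Dx.
  rewrite lee_fin subr_ge0 ge0_ler_powR ?nnegrE//; first exact: ltW.
  exact: le_trans Txx.
have mg : measurable_fun D g.
  apply/measurable_EFinP; apply: measurable_funB; apply/measurable_EFinP; [exact: (@mpw D)|exact: mpT].
have momentvE : moment alpha v = (I + \int[v]_(x in D) g x)%E.
  rewrite -ge0_integralD//.
  by apply: eq_integral => x _; rewrite /pw /g -EFinD addrC subrK.
have g_int0 : (\int[v]_(x in D) g x = 0)%E.
  apply/eqP; rewrite eq_le integral_ge0// andbT.
  by move: momentv_le; rewrite momentvE -[X in (_ <= X)%E]adde0 leeD2lE.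
have /ae_eq_integral_abs : (\int[v]_(x in D) `|g x| = 0)%E.
  by rewrite -[RHS]g_int0; apply: eq_integral => x /[!inE] Dx; rewrite gee0_abs// g0.
move=> /(_ mD mg) [N [mN N0 gN]].
apply: (@subset_measure0 _ _ _ v _ N) => //; first exact: measurableD.
move=> x [Cnx /= /eqP xk]; apply: gN => /= /(_ (C0 _ Cnx)) [].
rewrite /g TC// => /eqP; rewrite subr_eq0 => /eqP.
apply/eqP; rewrite gt_eqF// gt0_ltr_powR// ?nnegrE//.
  by rewrite (le_trans k0)// Ckle.
by rewrite lt_neqAle eq_sym xk Ckle.
Qed.

End Moment.

(** * The cycle of implications *)

Unset Implicit Arguments.

Theorem theorem6 (R : realType) (m theta delta : R) (Phi : R * R -> R)
    (hm : 0 < m) (htheta : 0 < theta < 1) (hdelta : 0 < delta)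
    (hPhi : cutoff m theta delta Phi)
    (alpha : R) (halpha : 1 < alpha)
    (J : set nat) (C : nat -> set R) (M : nat -> R)
    (hC : forall n, J n -> closed (C n) /\ C n `<=` `[0, +oo[)
    (hdisj : trivIset J C)
    (hblock : block_property theta delta J C)
    (hM : forall n, J n -> 0 < M n)
    (v : {finite_measure set (measurableTypeR R) -> \bar R})
    (hv : on_halfline v) :
  [<-> calF theta delta J C M alpha v /\ dissipation m Phi alpha v = 0%E;
       calF theta delta J C M alpha v /\
       is_minimum [set moment alpha w | w in calF theta delta J C M alpha]
         (moment alpha v);
       calF theta delta J C M alpha v /\ is_atomic_sum J C M v].
Proof.
have alpha0 : 0 < alpha by exact: lt_trans halpha.
have inC w n : calF theta delta J C M alpha w -> J n -> C n (inf (C n)).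
  exact: calF_min.
have infC n x : J n -> C n x -> 0 <= inf (C n) <= x.
  move=> Jn Cnx; have [_ C0] := hC _ Jn.
  have lb0 : lbound (C n) 0 by move=> y /C0; rewrite /= in_itv/= andbT.
  by rewrite lb_le_inf//; [apply: ge_inf => //; exists 0|exists x].
tfae.
- move=> [Fv Dv]; split => //; split; first by exists v.
  have [v0 _ Cv _] := Fv.
  have single n : J n -> C n `\ inf (C n) = set0.
    move=> Jn; rewrite -subset0 => x [Cnx xinf].
    have Bn : blocks theta delta (supp v) (C n) by rewrite -Cv; exists n.
    apply: (blocks_subsingleton htheta hdelta (@closed_supp _ v)
      (supp_halfline v0) _ Bn (inC _ _ Fv Jn) Cnx).
      by move=> a b; exact: (dissipation_eq0_not_linked hm hPhi alpha0 Dv).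
    rewrite lt_neqAle; have /andP[_ ->] := infC _ _ Jn Cnx; rewrite andbT.
    by apply/eqP => ix; apply: xinf.
  move=> _ [w Fw <-]; apply: (null_moment_le alpha0 hC hdisj Fv _ Fw) => n Jn.
  by rewrite single// measure0.
- move=> [Fv [_ minv]]; split => //.
  apply/(atomic_sumP hC hdisj hM Fv) => n Jn.
  by apply: (minimal_moment_null alpha0 hC hdisj hM Fv) => // w Fw; apply: minv; exists w.
- move=> [Fv /(atomic_sumP hC hdisj hM Fv) v0]; split => //.
  have [v00 _ Cv _] := Fv.
  (* One point per block: K is countable, hence measurable, and carries v; two distinct points of K
     lie in distinct blocks and so are never linked. *)
  pose K := \bigcup_(n in J) [set inf (C n)].
  have mK : measurable (K : set (measurableTypeR R)).
    by apply: bigcup_measurable => n _; exact: measurable_set1.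
  apply: (dissipation_eq0 hPhi alpha0 mK).
    apply: measure_negligible; first exact: measurableC.
    pose N n : set (measurableTypeR R) := if n \in J then C n `\ inf (C n) else set0.
    pose W : set (measurableTypeR R) := (~` \bigcup_(n in J) C n) `|` \bigcup_n N n.
    apply: (negligibleS (A := W)).
      move=> x nKx; have [[n Jn Cnx]|] := pselect ((\bigcup_(n in J) C n) x); last by left.
      right; exists n => //; rewrite /N mem_set//; split => //= xi; apply: nKx.
      by exists n.
    apply: negligibleU.
      apply/negligibleP; last exact: calF_setC Fv.
      by apply: measurableC; exact: (measurable_blocks hC).
    apply: negligible_bigcup => n; rewrite /N; case: ifPn => [/[!inE] Jn|_].
      apply/negligibleP; last exact: v0.
      by apply: measurableD => //; exact: (measurable_block hC Jn).
    exact: negligible_set0.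
  move=> x y [i Ji ->] [j Jj ->] i0 ij.
  apply: (not_linked_blocks htheta hdelta (B1 := C i) (B2 := C j) (S := supp v)) => //.
  + by rewrite -Cv; exists i.
  + by rewrite -Cv; exists j.
  + have nij : i != j by apply/eqP => eij; rewrite eij ltxx in ij.
    rewrite -subset0 => z zij; move/eqP: nij; apply; apply: (hdisj _ _ Ji Jj).
    by exists z.
  + exact: inC Fv Ji.
  + exact: inC Fv Jj.
  + exact: ltW.
Qed.
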